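(* Suppose primitive contracts are gross complements for all agents. Then a balanced price vector $\mathbf{p}\in\mathbb{B}$ is a non-equilibrium price vector if and only if there exists a complements chain at $\mathbf{p}$.
   Context: **Market.** $I$ is a finite set of agents and $\Omega$ a finite set of primitive contracts. Each $w\in\Omega$ has a set of participants $N(w)\subseteq I$ with $|N(w)|\ge 2$. For $\Psi\subseteq\Omega$ and $i\in I$ let $\Psi_i=\{w\in\Psi: i\in N(w)\}$; in particular $\Omega_i=\{w\in\Omega: i\in N(w)\}$. Each agent $i$ has a valuation $v_i:2^{\Omega_i}\to\mathbb{R}$. **Prices and demand.** Let $K=\{(i,w):i\in I,\ w\in\Omega_i\}$. For $\mathbf{p}\in\mathbb{R}^K$ write $\mathbf{p}_i=(p_i^w)_{w\in\Omega_i}$. The set of balanced price vectors is $\mathbb{B}=\{\mathbf{p}\in\mathbb{R}^K:\sum_{i\in N(w)}p_i^w=0\ \forall w\in\Omega\}$. Agent $i$'s demand correspondence is $D_i(\mathbf{p}_i)=\arg\max_{\Psi\subseteq\Omega_i}\{v_i(\Psi)-\sum_{w\in\Psi}p_i^w\}$. A pair $(\Phi,\mathbf{p})$ with $\Phi\subseteq\Omega$, $\mathbf{p}\in\mathbb{B}$ is a competitive equilibrium if $\Phi_i\in D_i(\mathbf{p}_i)$ for all $i\in I$; $\mathbf{p}\in\mathbb{B}$ is an equilibrium price vector if some such $\Phi$ exists, and a non-equilibrium price vector otherwise. **Gross complements.** Primitive contracts are gross complements for agent $i$ if for all $\mathbf{p}_i\ge\mathbf{q}_i$ in $\mathbb{R}^{\Omega_i}$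 (coordinatewise) and all $\Phi\in D_i(\mathbf{p}_i)$ there is $\Psi\in D_i(\mathbf{q}_i)$ with $\{w\in\Phi:p_i^w=q_i^w\}\subseteq\Psi$. **Verification procedure at $\mathbf{p}\in\mathbb{B}$.** Let $\underline{d}_i(\mathbf{p}_i)=\bigcap_{\Psi\in D_i(\mathbf{p}_i)}\Psi$ and $H(\mathbf{p})=\{w: w\in\underline{d}_i(\mathbf{p}_i)\text{ for some }i\in I\}$. Let $\Omega^1(\mathbf{p})=\Omega$. For $k\ge1$, given $\Omega^k(\mathbf{p})$, let $\overline{d}^k_i(\mathbf{p}_i)=\bigcup\{\Psi\in D_i(\mathbf{p}_i):\Psi\subseteq\Omega^k(\mathbf{p})\}$ for each $i\in I$ and $G^k(\mathbf{p})=\{w:\ w\in\overline{d}^k_j(\mathbf{p}_j)\text{ and }w\notin\overline{d}^k_{j'}(\mathbf{p}_{j'})\text{ for some }j,j'\in N(w)\}$. At Step $k\geq1$: (i) if $G^k(\mathbf{p})=\emptyset$, the procedure terminates; (ii) if $G^k(\mathbf{p})\cap H(\mathbf{p})\ne\emptyset$, it terminates; (iii) otherwise set $\Omega^{k+1}(\mathbf{p})=\Omega^k(\mathbf{p})\setminus G^k(\mathbf{p})$ and go to Step $k+1$. **Complements chain.** A primitive contract $w'\in\Omega_i$ is a complement to another primitive contract $w\in\Omega_i$ for agent $i$ at $\mathbf{p}_i$ if $w\in\Psi$ for some $\Psi\in D_i(\mathbf{p}_i)$, and every $\Psi\in D_i(\mathbf{p}_i)$ with $w\in\Psi$ satisfies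 $w'\in\Psi$. If the verification procedure at $\mathbf{p}$ stops at Step $s\ge1$ because $G^s(\mathbf{p})\cap H(\mathbf{p})\neq\emptyset$, a complements chain at $\mathbf{p}$ is a sequence $i^1w^1i^2w^2\cdots w^si^{s+1}$ of agents $i^l$ and primitive contracts $w^l$ with $w^l\in\Omega_{i^l}\cap\Omega_{i^{l+1}}$ for $1\le l\le s$ such that: (i) $w^l\in G^l(\mathbf{p})$, $w^l\notin\overline{d}^l_{i^l}(\mathbf{p}_{i^l})$ and $w^l\in\overline{d}^l_{i^{l+1}}(\mathbf{p}_{i^{l+1}})$ for all $1\le l\le s$; (ii) $w^s\in H(\mathbf{p})$ and $w^s\in\underline{d}_{i^{s+1}}(\mathbf{p}_{i^{s+1}})$; (iii) if $s\ge2$, $w^{l-1}$ is a complement to $w^l$ for agent $i^l$ at $\mathbf{p}_{i^l}$ for all $2\le l\le s$. (If the procedure stops because of case (i), there is no complements chain at $\mathbf{p}$.) *)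

(* Defs.v *)
From mathcomp Require Import all_boot all_order all_algebra.
From mathcomp Require Import reals.

Set Implicit Arguments.
Unset Strict Implicit.
Unset Printing Implicit Defensive.

Import Order.TTheory GRing.Theory Num.Theory.
Local Open Scope ring_scope.

(* A market is given by finite types [I] of agents and [Omega] of primitive
   contracts, the participants [N w] of each contract [w], and valuations [v].
   Functions on restricted domains are encoded as total functions:
   - [v i : 2^(Omega_i) -> R] is a function on all sets of contracts, only ever
     evaluated at subsets of [Omega_i];
   - [p : R^K], K = {(i, w) : w in Omega_i}, is a function [I -> Omega -> R],
     only ever evaluated at pairs [i], [w] with [i \in N w]. *)
Section Market.

Context {R : realType} {I Omega : finType}.
Context (N : Omega -> {set I}) (v : I -> {set Omega} -> R).

Implicit Types (i j : I) (w : Omega) (Phi Psi S : {set Omega}).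
Implicit Types (pi qi : Omega -> R) (p : I -> Omega -> R).

(* [contracts_of i Psi] is Psi_i. *)
Definition contracts_of i Psi : {set Omega} := [set w in Psi | i \in N w].

Definition all_contracts_of i : {set Omega} := contracts_of i [set: Omega].

Definition balanced p : Prop := forall w, \sum_(i in N w) p i w = 0.

Definition utility i pi Psi : R := v i Psi - \sum_(w in Psi) pi w.

Definition demand i pi : {set {set Omega}} :=
  [set Psi : {set Omega} | (Psi \subset all_contracts_of i) &&
    [forall Phi : {set Omega},
       (Phi \subset all_contracts_of i) ==> (utility i pi Phi <= utility i pi Psi)]].

Definition competitive_equilibrium Phi p : Prop :=
  balanced p /\ forall i, contracts_of i Phi \in demand i (p i).

Definition equilibrium_price p : Prop :=
  exists Phi, competitive_equilibrium Phi p.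

Definition non_equilibrium_price p : Prop :=
  balanced p /\ ~ equilibrium_price p.

Definition gross_complements i : Prop :=
  forall pi qi : Omega -> R,
    (forall w, w \in all_contracts_of i -> qi w <= pi w) ->
    forall Phi, Phi \in demand i pi ->
    exists2 Psi, Psi \in demand i qi & [set w in Phi | pi w == qi w] \subset Psi.

(* The demand is never empty, so this is a genuine intersection of demanded
   sets. *)
Definition lower_demand i pi : {set Omega} :=
  \bigcap_(Psi in demand i pi) Psi.

Definition required p : {set Omega} :=
  [set w | [exists i, w \in lower_demand i (p i)]].

Definition upper_demand_in S i pi : {set Omega} :=
  \bigcup_(Psi in demand i pi | Psi \subset S) Psi.

Definition disputed_in S p : {set Omega} :=
  [set w | [exists j in N w, exists j' in N w,
     (w \in upper_demand_in S j (p j)) &&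
     (w \notin upper_demand_in S j' (p j'))]].

(* Steps are numbered from 1, so [remaining p 1] is the whole of [Omega] (and
   [remaining p 0] is irrelevant).  The recursion is continued past the
   termination of the procedure; [stops_by_conflict] accounts for
   termination. *)
Definition remaining p (k : nat) : {set Omega} :=
  iter k.-1 (fun S => S :\: disputed_in S p) [set: Omega].

Definition upper_demand p (k : nat) i : {set Omega} :=
  upper_demand_in (remaining p k) i (p i).

Definition disputed p (k : nat) : {set Omega} :=
  disputed_in (remaining p k) p.

(* The procedure goes through steps 1, ..., s - 1 without terminating and
   terminates at step s because a disputed contract is required. *)
Definition stops_by_conflict p (s : nat) : Prop :=
  [/\ (1 <= s)%N,
      forall k, (1 <= k < s)%N ->
        disputed p k != set0 /\ disputed p k :&: required p = set0
    & disputed p s :&: required p != set0].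

Definition complement_to i pi (w' w : Omega) : Prop :=
  [/\ w' \in all_contracts_of i, w \in all_contracts_of i, w' != w,
      exists2 Psi, Psi \in demand i pi & w \in Psi
    & forall Psi, Psi \in demand i pi -> w \in Psi -> w' \in Psi].

(* The sequence i^1 w^1 i^2 w^2 ... w^s i^(s+1) is given by [a l] = i^l for
   1 <= l <= s + 1 and [c l] = w^l for 1 <= l <= s; other values of [a] and
   [c] are irrelevant. *)
Definition complements_chain p (s : nat) (a : nat -> I) (c : nat -> Omega) : Prop :=
  [/\ stops_by_conflict p s,
      forall l, (1 <= l <= s)%N ->
        c l \in all_contracts_of (a l) :&: all_contracts_of (a l.+1),
      forall l, (1 <= l <= s)%N ->
        [/\ c l \in disputed p l, c l \notin upper_demand p l (a l)
          & c l \in upper_demand p l (a l.+1)],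
      c s \in required p /\ c s \in lower_demand (a s.+1) (p (a s.+1))
    & forall l, (2 <= l <= s)%N ->
        complement_to (a l) (p (a l)) (c l.-1) (c l)].

End Market.

(* Main.v *)
(** Gross complementarity makes the demanded sets upward directed at every price
    vector: lowering the prices of the contracts of a demanded set [Phi] by one
    leaves exactly the demanded supersets of [Phi] in demand.  Directedness at
    all prices forces the valuations to be supermodular, so demands are closed
    under unions and intersections.

    An equilibrium outcome never meets a disputed set, hence survives all steps
    and excludes a conflict.  Conversely, if the procedure stops without
    conflict, the smallest demanded sets survive, and the largest demanded sets
    among the remaining contracts agree and form an equilibrium.  After a
    conflict the chain is traced backwards: if [w] survives step [l] but is
    rejected by [i] at step [l + 1], then the least set demanded by [i] that
    contains [w] must contain a contract disputed at step [l]. *)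
Require Import Defs.
From mathcomp Require Import all_boot all_order all_algebra.
From mathcomp Require Import reals.
From mathcomp Require Import zify lra.

Set Implicit Arguments.
Unset Strict Implicit.
Unset Printing Implicit Defensive.

Import Order.TTheory GRing.Theory Num.Theory.
Local Open Scope ring_scope.

(** * Demand of a single agent *)

Section Demand.

Context {R : realType} {I Omega : finType}.
Context (N : Omega -> {set I}) (v : I -> {set Omega} -> R) (i : I).

Local Notation T := (all_contracts_of N i).
Local Notation V := (v i).

Implicit Types (w x y : Omega) (A B S Phi Psi : {set Omega}) (pi : Omega -> R).

Lemma demandP pi Psi :
  reflect (Psi \subset T /\
           forall Phi, Phi \subset T -> utility v i pi Phi <= utility v i pi Psi)
          (Psi \in demand N v i pi).
Proof.
rewrite inE; apply: (iffP andP) => -[PsiT maxPsi]; split=> //.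
  by move=> Phi; apply/implyP; move: Phi; apply/forallP.
by apply/forallP => Phi; apply/implyP/maxPsi.
Qed.

Lemma demand_sub pi Psi : Psi \in demand N v i pi -> Psi \subset T.
Proof. by case/demandP. Qed.

Lemma demand_nonempty pi : exists Psi, Psi \in demand N v i pi.
Proof.
have := @arg_maxP _ _ _ set0 (fun Psi => Psi \subset T) (utility v i pi).
case=> [|Psi PsiT maxPsi]; first exact: sub0set.
by exists Psi; apply/demandP; split.
Qed.

Lemma sum_indicator A Psi :
  \sum_(w in Psi) (w \in A)%:R = #|Psi :&: A|%:R :> R.
Proof.
rewrite -natr_sum -sum1_card -big_mkcondr; congr (_%:R).
by apply: eq_bigl => w; rewrite inE.
Qed.

Lemma demand_directed pi A B :
    gross_complements N v i ->
    A \in demand N v i pi -> B \in demand N v i pi ->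
  exists2 Psi, Psi \in demand N v i pi & A :|: B \subset Psi.
Proof.
move=> gc Ad Bd; pose qi w := pi w - (w \in A)%:R.
have qiE Psi : utility v i qi Psi = utility v i pi Psi + #|Psi :&: A|%:R.
  by rewrite /utility sumrB sum_indicator opprB addrA addrAC.
have [|Psi /demandP[PsiT maxPsi] subPsi] := gc pi qi _ B Bd.
  by move=> w _; rewrite lerBlDr lerDl ler0n.
have [[AT maxA] [BT maxB]] := (demandP _ _ Ad, demandP _ _ Bd).
have := maxPsi _ AT; rewrite !qiE setIid => leA.
have leAPsi := maxA _ PsiT.
have cardI : (#|Psi :&: A| <= #|A|)%N by rewrite subset_leq_card ?subsetIr.
have cardIR : (#|Psi :&: A|%:R <= #|A|%:R :> R) by rewrite ler_nat.
(* [Psi] beats [A] at [qi] while [A] beats [Psi] at [pi], so [Psi] must collect the whole discount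
   [#|A|]. *)
have AsubPsi : A \subset Psi.
  apply/setIidPr/eqP; rewrite eqEcard subsetIr /= -(ler_nat R); lra.
exists Psi.
  by apply/demandP; split=> // Phi PhiT; have := maxA _ PhiT; lra.
rewrite subUset AsubPsi; apply/subsetP => w wB.
have [/(subsetP AsubPsi)//|wA] := boolP (w \in A).
by apply: (subsetP subPsi); rewrite inE wB /qi (negPf wA) subr0 eqxx.
Qed.

(** * Supermodular valuations and the lattice of demanded sets *)

Hypothesis gc : gross_complements N v i.

(* If the inequality failed, prices could be chosen so that [x |: S] and
   [y |: S] are demanded but no superset of both is: contracts in [S] are very
   cheap, those outside [x |: (y |: S)] very expensive, and [x], [y] cost their
   marginal values at [S]. *)
Lemma local_supermodular S x y :
    S \subset T -> x \in T -> y \in T -> x \notin S -> y \notin S -> x != y ->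
  V (x |: S) + V (y |: S) <= V (x |: (y |: S)) + V S.
Proof.
move=> ST xT yT xS yS xy; rewrite leNgt; apply/negP => sub.
pose M := \sum_(Psi : {set Omega}) `|V Psi|.
have VM Psi : - M <= V Psi <= M.
  by rewrite -ler_norml /M (bigD1 Psi) //= lerDl sumr_ge0.
(* Six values of [V], each at most [M] in absolute value, enter the comparison with [S]: [V Psi],
   [V S], and two in each of [px] and [py]. *)
pose L := M *+ 6 + 1.
pose U := x |: (y |: S).
pose px := V (x |: S) - V S; pose py := V (y |: S) - V S.
pose pi w : R := px * (w \in [set x])%:R + py * (w \in [set y])%:R
  - L * (w \in S)%:R + L * (w \in ~: U)%:R.
have utE Psi : utility v i pi Psi = V Psi - px * (x \in Psi)%:R
    - py * (y \in Psi)%:R + L * #|Psi :&: S|%:R - L * #|Psi :&: ~: U|%:R.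
  have card1 z : #|Psi :&: [set z]| = (z \in Psi).
    have [zPsi|zPsi] := boolP (z \in Psi).
      by rewrite (setIidPr _) ?sub1set ?cards1.
    by apply/eqP; rewrite cards_eq0 setI_eq0 disjoint_sym disjoints1.
  rewrite /utility !big_split /= sumrN -!mulr_sumr !sum_indicator !card1; lra.
have L1 : 1 <= L by have := VM S; rewrite /L; lra.
have small Psi : ~~ ((S \subset Psi) && (Psi \subset U)) ->
    utility v i pi Psi < V S + L * #|S|%:R.
  move=> notB.
  have : L * #|Psi :&: S|%:R - L * #|Psi :&: ~: U|%:R <= L * (#|S|%:R - 1).
    rewrite -mulrBr ler_wpM2l //; first by lra.
    suff : (#|Psi :&: S| + 1 <= #|S| + #|Psi :&: ~: U|)%N.
      by rewrite -(ler_nat R) !natrD; lra.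
    move: notB; rewrite negb_and => /orP[SPsi|PsiU].
      have : (#|Psi :&: S| < #|S|)%N.
        rewrite proper_card // properEneq subsetIr andbT.
        by apply: contraNneq SPsi => /setIidPr.
      lia.
    have : (0 < #|Psi :&: ~: U|)%N.
      by rewrite card_gt0 setI_eq0 -subsets_disjoint.
    have : (#|Psi :&: S| <= #|S|)%N by rewrite subset_leq_card ?subsetIr.
    lia.
  rewrite utE; have := VM Psi; have := VM S; have := VM (x |: S).
  have := VM (y |: S); rewrite /px /py /L.
  by case: (x \in Psi); case: (y \in Psi); rewrite ?mulr1 ?mulr0; lra.
have utB Psi : S \subset Psi -> Psi \subset U -> utility v i pi Psi =
    V Psi - px * (x \in Psi)%:R - py * (y \in Psi)%:R + L * #|S|%:R.
  move=> /setIidPr SPsi; rewrite subsets_disjoint -setI_eq0 => /eqP PsiU.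
  by rewrite utE SPsi PsiU cards0 mulr0 subr0.
have SU : S \subset U by rewrite /U !subsetU ?subxx ?orbT.
have yU : y |: S \subset U by rewrite subsetUr.
have xU : x |: S \subset U by rewrite setUS ?subsetUr.
(* Only four sets lie between [S] and [U]: [S], [x |: S] and [y |: S] tie at this bound, and [U]
   falls strictly below it by [sub]. *)
have best Psi : utility v i pi Psi <= V S + L * #|S|%:R.
  have [/andP[SPsi PsiU]|/small/ltW//] := boolP ((S \subset Psi) && (Psi \subset U)).
  rewrite utB // lerD2r /px /py.
  have PsiE A : S \subset A -> (x \in A) = (x \in Psi) ->
      (y \in A) = (y \in Psi) -> A \subset U -> Psi = A.
    move=> SA xA yA AU; apply/setP => z.
    move: (subsetP SPsi z) (subsetP PsiU z) (subsetP SA z) (subsetP AU z).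
    rewrite !inE; have [->|_] := eqVneq z x; first by rewrite xA.
    have [->|_] /= := eqVneq z y; first by rewrite yA.
    case: (z \in S) => [-> // _ -> //|_ h _ h'].
    by apply/idP/idP => [/h|/h'].
  have [xPsi|xPsi] := boolP (x \in Psi); have [yPsi|yPsi] := boolP (y \in Psi);
    rewrite ?mulr1 ?mulr0.
  - rewrite (PsiE U) ?inE ?eqxx ?xPsi ?yPsi ?orbT //; lra.
  - rewrite (PsiE (x |: S)) ?subsetUr ?inE ?eqxx ?orbT //; first by lra.
    by rewrite eq_sym (negPf xy) (negPf yS) (negPf yPsi).
  - rewrite (PsiE (y |: S)) ?subsetUr ?inE ?eqxx ?orbT //; first by lra.
    by rewrite (negPf xy) (negPf xS) (negPf xPsi).
  - by rewrite (PsiE S) ?(negPf xS) ?(negPf yS) ?(negPf xPsi) ?(negPf yPsi) //; lra.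
have xd : x |: S \in demand N v i pi.
  apply/demandP; split; first by rewrite subUset sub1set xT.
  move=> Phi _; apply: le_trans (best Phi) _.
  rewrite utB ?subsetUr // !inE !eqxx (eq_sym y) (negPf xy) (negPf yS) /px.
  rewrite mulr1 mulr0; lra.
have yd : y |: S \in demand N v i pi.
  apply/demandP; split; first by rewrite subUset sub1set yT.
  move=> Phi _; apply: le_trans (best Phi) _.
  rewrite utB ?subsetUr // !inE !eqxx (negPf xy) (negPf xS) /py mulr1 mulr0; lra.
have [Psi /demandP[_ maxPsi]] := demand_directed gc xd yd.
rewrite !subUset !sub1set => /andP[/andP[xPsi SPsi] /andP[yPsi _]].
have := maxPsi _ ST; rewrite (utB S) // (negPf xS) (negPf yS).
have [PsiU|PsiU] := boolP (Psi \subset U); last first.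
  by rewrite leNgt !mulr0 !subr0 small // (negPf PsiU) andbF.
have -> : Psi = U.
  by apply/eqP; rewrite eqEsubset PsiU !subUset !sub1set xPsi yPsi.
rewrite utB // !inE !eqxx orbT !mulr1 !mulr0 /px /py /U; lra.
Qed.

(** Telescopes the local inequality while [S] grows to [A] one contract at a time. *)
Lemma increasing_marginal S A w :
    S \subset A -> A \subset T -> w \in T -> w \notin A ->
  V (w |: S) + V A <= V (w |: A) + V S.
Proof.
move: {2}#|A :\: S| (leqnn #|A :\: S|) => n.
elim: n A => [|n IHn] A leAn SA AT wT wA.
  suff -> : A = S by [].
  apply/eqP; rewrite eqEsubset SA andbT -setD_eq0 -cards_eq0.
  by rewrite -leqn0.
have [/eqP|[y yAS]] := set_0Vmem (A :\: S).
  rewrite setD_eq0 => AS; suff -> : A = S by [].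
  by apply/eqP; rewrite eqEsubset AS.
move: (yAS); rewrite inE => /andP[yS yA].
have SA' : S \subset A :\ y by rewrite subsetD1 SA.
have AE : y |: (A :\ y) = A by rewrite setD1K.
have A'T : A :\ y \subset T by apply: subset_trans AT; rewrite subD1set.
have wA' : w \notin A :\ y by rewrite inE negb_and wA orbT.
have wy : w != y by apply: contraNneq wA => ->.
have yT : y \in T by apply: (subsetP AT).
have y' : y \notin A :\ y by rewrite !inE eqxx.
have := local_supermodular A'T wT yT wA' y' wy; rewrite AE.
have : (#|(A :\ y) :\: S| <= n)%N.
  have -> : (A :\ y) :\: S = (A :\: S) :\ y by rewrite setDDl setUC -setDDl.
  by move: leAn; rewrite (cardsD1 y) yAS.
move=> /IHn /(_ SA' A'T wT wA'); lra.
Qed.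

(** Induction on [B :\: A]: a contract [y] of this difference adds at least as much to
    [A :|: B :\ y] as to its subset [B :\ y]. *)
Lemma supermodular A B :
  A \subset T -> B \subset T -> V A + V B <= V (A :|: B) + V (A :&: B).
Proof.
move: {2}#|B :\: A| (leqnn #|B :\: A|) => n.
elim: n B => [|n IHn] B leBn AT BT.
  have BA : B \subset A by rewrite -setD_eq0 -cards_eq0 -leqn0.
  by rewrite (setUidPl BA) (setIidPr BA).
have [/eqP|[y yBA]] := set_0Vmem (B :\: A).
  by rewrite setD_eq0 => BA; rewrite (setUidPl BA) (setIidPr BA).
move: (yBA); rewrite inE => /andP[yA yB].
have BE : y |: (B :\ y) = B by rewrite setD1K.
have B'T : B :\ y \subset T by apply: subset_trans BT; rewrite subD1set.
have ABE : y |: (A :|: B :\ y) = A :|: B by rewrite setUCA BE.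
have AIB : A :&: (B :\ y) = A :&: B.
  apply/setP => z; rewrite !inE; have [->|//] := eqVneq z y.
  by rewrite (negPf yA).
have yT : y \in T by apply: (subsetP BT).
have y' : y \notin A :|: B :\ y by rewrite !inE eqxx (negPf yA).
have ABT : A :|: B :\ y \subset T by rewrite subUset AT.
have := increasing_marginal (subsetUr A (B :\ y)) ABT yT y'; rewrite BE ABE.
have : (#|(B :\ y) :\: A| <= n)%N.
  have -> : (B :\ y) :\: A = (B :\: A) :\ y by rewrite setDDl setUC -setDDl.
  by move: leBn; rewrite (cardsD1 y) yBA.
move=> /IHn /(_ AT B'T); rewrite AIB; lra.
Qed.

(** Payments are modular, so utility is supermodular too; as neither the union nor the intersection
    can exceed the maximum, both attain it. *)
Lemma demand_lattice pi A B :
    A \in demand N v i pi -> B \in demand N v i pi ->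
  (A :|: B \in demand N v i pi) && (A :&: B \in demand N v i pi).
Proof.
move=> /demandP[AT maxA] /demandP[BT maxB].
have ABT : A :|: B \subset T by rewrite subUset AT.
have AIT : A :&: B \subset T by apply: subset_trans AT; rewrite subsetIl.
have modular : utility v i pi A + utility v i pi B <=
    utility v i pi (A :|: B) + utility v i pi (A :&: B).
  rewrite /utility; have := supermodular AT BT.
  rewrite (big_setID (A := A :|: B) A) /= setUK setDUl setDv set0U.
  rewrite (big_setID (A := B) A) /= (setIC B); lra.
have leU := maxA _ ABT; have leI := maxB _ AIT.
apply/andP; split; apply/demandP; split=> // Phi PhiT.
  by have := maxA _ PhiT; lra.
by have := maxB _ PhiT; lra.
Qed.

(** The witness [Psi0] keeps the family nonempty; an empty intersection would be the full set. *)
Lemma demand_bigcap pi (P : pred {set Omega}) Psi0 :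
    Psi0 \in demand N v i pi -> P Psi0 ->
  \bigcap_(Psi in demand N v i pi | P Psi) Psi \in demand N v i pi.
Proof.
move=> d0 P0; rewrite (bigD1 Psi0) ?d0 //=.
elim/big_rec: _ => [|Psi X /andP[/andP[dPsi _] _] dX]; first by rewrite setIT.
by rewrite setICA; case/andP: (demand_lattice dPsi dX).
Qed.

Lemma lower_demand_in pi : lower_demand N v i pi \in demand N v i pi.
Proof.
have [Psi0 d0] := demand_nonempty pi.
have := @demand_bigcap pi predT Psi0 d0 isT.
by under eq_bigl do rewrite andbT.
Qed.

Lemma upper_demand_in_sub S pi : upper_demand_in N v S i pi \subset S.
Proof. by apply/bigcupsP => Psi /andP[]. Qed.

Lemma upper_demand_in_max S pi Psi :
  Psi \in demand N v i pi -> Psi \subset S -> Psi \subset upper_demand_in N v S i pi.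
Proof. by move=> dPsi PsiS; apply: bigcup_sup; rewrite dPsi. Qed.

(** The hypothesis makes the least demanded set a member of the union, which thus is not an empty
    one. *)
Lemma upper_demand_in_demand S pi :
    lower_demand N v i pi \subset S ->
  upper_demand_in N v S i pi \in demand N v i pi.
Proof.
move=> lowS; rewrite /upper_demand_in (bigD1 (lower_demand N v i pi)) /=.
  elim/big_rec: _ => [|Psi X /andP[/andP[dPsi _] _] dX].
    by rewrite setU0 lower_demand_in.
  by rewrite setUCA; case/andP: (demand_lattice dPsi dX).
by rewrite lower_demand_in.
Qed.

End Demand.

(** * The verification procedure and equilibrium *)

Section Procedure.

Context {R : realType} {I Omega : finType}.
Context (N : Omega -> {set I}) (v : I -> {set Omega} -> R).
Context (p : I -> Omega -> R).

Implicit Types (i j : I) (w : Omega) (S Phi Psi : {set Omega}) (k l : nat).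

Local Notation dem j := (demand N v j (p j)).
Local Notation lower j := (lower_demand N v j (p j)).
Local Notation upper := (upper_demand N v p).
Local Notation left := (remaining N v p).
Local Notation disp := (disputed N v p).

Lemma remainingS k : left k.+2 = left k.+1 :\: disp k.+1.
Proof. by []. Qed.

Lemma upper_demand_mono k i : upper k.+2 i \subset upper k.+1 i.
Proof.
apply/bigcupsP => Psi /andP[dPsi PsiS]; apply: upper_demand_in_max => //.
by apply: subset_trans PsiS _; rewrite remainingS subsetDl.
Qed.

Lemma disputedP k w :
  reflect (exists j j',
             [/\ j \in N w, j' \in N w, w \in upper k j & w \notin upper k j'])
          (w \in disp k).
Proof.
rewrite inE; apply: (iffP existsP) => [[j /andP[jw /existsP[j' /and3P[]]]]|].
  by move=> *; exists j, j'.
case=> j [j' [jw j'w wj wj']]; exists j; rewrite jw; apply/existsP.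
by exists j'; apply/and3P.
Qed.

Lemma disputed_sub k : disp k \subset left k.
Proof.
apply/subsetP => w /disputedP[j [j' [_ _ wj _]]].
exact: (subsetP (upper_demand_in_sub _ _ _ _ _)) wj.
Qed.

(** Every participant [j'] of a contract in [Phi] demands its share of [Phi], which is still
    available, so none of them rejects the contract. *)
Lemma equilibrium_undisputed Phi k :
    (forall i, contracts_of N i Phi \in dem i) ->
  Phi \subset left k.+1 -> [disjoint Phi & disp k.+1].
Proof.
move=> eqPhi PhiS; rewrite -setI_eq0; apply/eqP/setP => w; rewrite !in_set0 inE.
apply/negP => /andP[wPhi /disputedP[j [j' [_ j'w _ /negP[]]]]].
have sub : contracts_of N j' Phi \subset left k.+1.
  by apply: subset_trans PhiS; apply/subsetP => z; rewrite inE => /andP[].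
apply: (subsetP (upper_demand_in_max (eqPhi j') sub)).
by rewrite inE wPhi.
Qed.

Lemma equilibrium_remaining Phi k :
  (forall i, contracts_of N i Phi \in dem i) -> Phi \subset left k.+1.
Proof.
move=> eqPhi; elim: k => [|k IHk]; first exact: subsetT.
by rewrite remainingS subsetD IHk equilibrium_undisputed.
Qed.

Lemma conflict_non_equilibrium s :
  stops_by_conflict N v p s -> ~ equilibrium_price N v p.
Proof.
case: s => [[]//|s] [_ _ /set0Pn[w /setIP[wG wH]]] [Phi [_ eqPhi]].
move: wH; rewrite inE => /existsP[i /bigcapP /(_ _ (eqPhi i))].
rewrite inE => /andP[wPhi _].
have := equilibrium_undisputed eqPhi (equilibrium_remaining s eqPhi).
by move/disjointFr => /(_ _ wPhi); rewrite wG.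
Qed.

Lemma lower_demand_remaining k i :
    (forall l, (1 <= l <= k)%N -> disp l :&: required N v p = set0) ->
  lower i \subset left k.+1.
Proof.
elim: k => [|k IHk] noH; first exact: subsetT.
rewrite remainingS subsetD IHk => [|l /andP[l1 lk]]; last first.
  by apply: noH; rewrite l1 leqW.
rewrite disjoint_sym disjoints_subset; apply/subsetP => w wG; rewrite inE.
apply/negP => wi; suff : w \in disp k.+1 :&: required N v p by rewrite noH ?inE ?leqnn.
by rewrite !inE; apply/andP; split; [move: wG; rewrite inE | apply/existsP; exists i].
Qed.

Hypothesis gc : forall i, gross_complements N v i.

(** Without disputes, a contract wanted by one participant is wanted by all, so the largest
    available demanded sets fit together into one outcome. *)
Lemma undisputed_equilibrium s :
    balanced N p -> disp s.+1 = set0 ->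
    (forall l, (1 <= l <= s)%N -> disp l :&: required N v p = set0) ->
  equilibrium_price N v p.
Proof.
move=> bal noG noH.
exists [set w | [exists i in N w, w \in upper s.+1 i]]; split=> // i.
suff -> : contracts_of N i [set w | [exists i in N w, w \in upper s.+1 i]] =
    upper s.+1 i.
  exact/upper_demand_in_demand/lower_demand_remaining.
apply/setP => w; rewrite !inE; apply/andP/idP.
  case=> /existsP[j /andP[jw wj]] iw; apply: contraT => wi.
  suff : w \in disp s.+1 by rewrite noG inE.
  by apply/disputedP; exists j, i.
move=> wi; have iw : i \in N w.
  case/bigcupP: (wi) => Psi /andP[/demand_sub/subsetP sub _] /sub.
  by rewrite !inE.
by split=> //; apply/existsP; exists i; rewrite iw.
Qed.

Lemma procedure_stops :
    balanced N p -> ~ equilibrium_price N v p ->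
  exists s, stops_by_conflict N v p s.
Proof.
move=> bal noeq.
(* Indices are shifted: [stop k] concerns step [k.+1]. Each step that does not stop removes a
   contract, so [#|Omega|.+1] such steps are impossible. *)
pose stop k := (disp k.+1 == set0) || (disp k.+1 :&: required N v p != set0).
have exstop : exists k, stop k.
  have [/existsP[k stopk]|] := boolP [exists k : 'I_(#|Omega|.+1), stop k].
    by exists k.
  rewrite negb_exists => /forallP nostop.
  have card k : (k <= #|Omega|.+1 -> #|left k.+1| + k <= #|Omega|)%N.
    elim: k => [_|k IHk lek]; first by rewrite addn0 max_card.
    have := nostop (Ordinal lek); rewrite /stop negb_or -card_gt0 => /andP[G0 _].
    have := IHk (ltnW lek); rewrite remainingS cardsD.
    have : (#|disp k.+1| <= #|left k.+1|)%N by rewrite subset_leq_card ?disputed_sub.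
    rewrite (setIidPr (disputed_sub _)); move: G0 => /=; lia.
  by have := card _ (leqnn _); lia.
case: (ex_minnP exstop) => s stops mins.
have before l : (1 <= l <= s)%N ->
    disp l != set0 /\ disp l :&: required N v p = set0.
  case: l => // l ls; have : ~~ stop l by apply/negP => /mins; lia.
  by rewrite negb_or negbK => /andP[? /eqP].
exists s.+1; split=> //.
case/orP: stops => [/eqP noG|//]; case: noeq.
by apply: (undisputed_equilibrium bal noG) => l /before[].
Qed.

(** * Backward construction of complements chains *)

Lemma chain_step k w i :
    w \in disp k.+2 -> i \in N w -> w \notin upper k.+2 i ->
  exists w', [/\ w' \in disp k.+1, w' \in upper k.+1 i
               & complement_to N v i (p i) w' w].
Proof.
move=> wG iw wi.
have wleft : w \in left k.+1 :\: disp k.+1.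
  by rewrite -remainingS (subsetP (disputed_sub _)).
move: wleft; rewrite inE => /andP[wG' wS].
(* Some [j] still accepts [w] at step [k.+2], hence at [k.+1]; a rejection by [i] there would have
   removed [w] already. *)
have wi1 : w \in upper k.+1 i.
  apply: contraT => wi1; case/disputedP: wG => j [_ [jw _ wj _]].
  case/negP: wG'; apply/disputedP; exists j, i; split=> //.
  exact: (subsetP (upper_demand_mono _ _)).
case/bigcupP: wi1 => Psi0 /andP[d0 Psi0S] w0.
pose Psi := \bigcap_(X in dem i | w \in X) X.
have dPsi : Psi \in dem i.
  exact: (demand_bigcap (@gc i) (P := fun X => w \in X) d0 w0).
have wPsi : w \in Psi by apply/bigcapP => X /andP[].
have PsiS : Psi \subset left k.+1.
  by apply: subset_trans Psi0S; apply: bigcap_inf; rewrite d0.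
(* Otherwise [Psi] would survive to step [k.+2] and [i] would accept [w] there. *)
have : ~~ [disjoint Psi & disp k.+1].
  apply: contra wi => dis; apply: (subsetP (upper_demand_in_max dPsi _)) => //.
  by rewrite remainingS subsetD PsiS.
rewrite -setI_eq0 => /set0Pn[w' /setIP[w'Psi w'G]]; exists w'; split=> //.
  exact: (subsetP (upper_demand_in_max dPsi PsiS)).
split.
- exact: (subsetP (demand_sub dPsi)).
- exact: (subsetP (demand_sub dPsi)).
- by apply: contraNneq wG' => <-.
- by exists Psi.
- by move=> X dX wX; apply: (bigcapP w'Psi); rewrite dX.
Qed.

(** The last contract and its rejecting agent are prescribed, so that the induction can append a
    link at the end. The agent accepting the last contract is left open. *)
Lemma chain_prefix k w i :
    w \in disp k.+1 -> i \in N w -> w \notin upper k.+1 i ->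
  exists (a : nat -> I) (c : nat -> Omega),
    [/\ a k.+1 = i, c k.+1 = w,
        forall l, (1 <= l <= k.+1)%N ->
          [/\ c l \in disp l, a l \in N (c l) & c l \notin upper l (a l)]
      & forall l, (1 <= l <= k)%N -> c l \in upper l (a l.+1) /\
          complement_to N v (a l.+1) (p (a l.+1)) (c l) (c l.+1)].
Proof.
elim: k w i => [|k IHk] w i wG iw wi.
  exists (fun=> i), (fun=> w); split=> // [l|l]; last by lia.
  by move=> l1; have -> : l = 1%N by lia.
have [w' [w'G w'i compl]] := chain_step wG iw wi.
case/disputedP: (w'G) => _ [j [_ jw' _ w'j]].
have [a [c [aE cE ac link]]] := IHk w' j w'G jw' w'j.
exists (fun l => if l == k.+2 then i else a l), (fun l => if l == k.+2 then w else c l).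
rewrite !eqxx; split=> // l ll.
  have [->//|ne] := eqVneq l k.+2; apply: ac; lia.
rewrite eqSS (_ : (l == k.+2) = false); last by apply/eqP; lia.
have [->|ne] := eqVneq l k.+1; first by rewrite cE.
by apply: link; lia.
Qed.

Lemma conflict_chain s :
    stops_by_conflict N v p s ->
  exists (a : nat -> I) (c : nat -> Omega), complements_chain N v p s a c.
Proof.
case: s => [[]//|s] stop; case: (stop) => _ before /set0Pn[w /setIP[wG wH]].
case/disputedP: (wG) => _ [i [_ iw _ wi]].
have [a [c [aE cE ac link]]] := chain_prefix wG iw wi.
have := wH; rewrite inE => /existsP[j wj].
(* The chain closes with an agent [j] requiring [w]: its least demanded set survives all earlier
   steps, so [j] accepts [w] at the last one. *)
have wj' : w \in upper s.+1 j.
  apply: (subsetP (upper_demand_in_max (lower_demand_in (@gc j) _) _)) wj.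
  by apply: lower_demand_remaining => l ll; case: (before l).
pose a' l := if l == s.+2 then j else a l.
have a'E l : (l <= s.+1)%N -> a' l = a l.
  by move=> ls; rewrite /a' (_ : (l == s.+2) = false) //; apply/eqP; lia.
have upl l : (1 <= l <= s.+1)%N -> c l \in upper l (a' l.+1).
  move=> ll; have [->|ne] := eqVneq l s.+1; first by rewrite cE /a' eqxx.
  rewrite a'E; last by lia.
  by have [] := link l ltac:(lia).
have upT l i' : upper l i' \subset all_contracts_of N i'.
  by apply/bigcupsP => Psi /andP[/demand_sub].
exists a', c; split=> //.
- move=> l ll; rewrite inE (subsetP (upT l _) _ (upl l ll)) andbT.
  by rewrite a'E ?inE; [have [] := ac l ll | lia].
- move=> l ll; have [? ? ?] := ac l ll.
  by split=> //; [rewrite a'E //; lia | exact: upl].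
- by rewrite cE /a' eqxx.
- case=> [|[|l]] // ll; rewrite a'E; last by lia.
  by have [] := link l.+1 ltac:(lia).
Qed.

End Procedure.

Theorem proposition1 (R : realType) (I Omega : finType)
    (N : Omega -> {set I}) (v : I -> {set Omega} -> R)
    (participants_ge2 : forall w : Omega, (2 <= #|N w|)%N)
    (gross_compl : forall i : I, gross_complements N v i)
    (p : I -> Omega -> R) (p_balanced : balanced N p) :
  non_equilibrium_price N v p <->
  exists (s : nat) (a : nat -> I) (c : nat -> Omega), complements_chain N v p s a c.
Proof.
split=> [[_ noeq]|[s [a [c [stop _ _ _ _]]]]].
  have [s stop] := procedure_stops gross_compl p_balanced noeq.
  by exists s; apply: conflict_chain.
by split=> //; apply: conflict_non_equilibrium stop.
Qed.
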